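(* Let $q$ be real with $|q|<1$, and let $S(q)=[-2/\sqrt{1-q},\,2/\sqrt{1-q}]$. (i) Let $a,b$ be real with $|b|>|a|$ and let $x,y\in S(q)$. Then $$0\le \sum_{n\ge 0}\frac{a^n}{[n]_q!\,b^n}H_n(x|a,q)H_n(y|b,q)=\left(a^2/b^2;q\right)_\infty\prod_{k=0}^\infty\frac{1-(1-q)xaq^k+(1-q)a^2q^{2k}}{w\left(x,y,q^k a/b\,|\,q\right)}.$$ (ii) Let $a,b$ be real with $|b|>|a|$ and $|a|\sqrt{1-q}<1$, and let $x,y\in S(q)$. Then $$\frac{1}{\sum_{n\ge 0}\frac{a^n}{[n]_q!\,b^n}H_n(x|a,q)H_n(y|b,q)}=\sum_{n\ge 0}\frac{a^n}{[n]_q!\,b^n\,(a^2/b^2;q)_n}B_n(y|b,q)P_n(x|y,a/b,q).$$ (iii) Let $\rho_1,\rho_2$ be real with $|\rho_1|,|\rho_2|<1$ and let $x,y,z\in S(q)$. Then $$0\le\sum_{n\ge 0}\frac{\rho_1^n}{[n]_q!\,(\rho_1^2\rho_2^2;q)_n}P_n(x|y,\rho_1\rho_2,q)P_n(z|y,\rho_2,q)=\frac{(\rho_1^2;q)_\infty}{(\rho_1^2\rho_2^2;q)_\infty}\prod_{k=0}^\infty\frac{w(x,y,q^k\rho_1\rho_2|q)}{w(x,z,q^k\rho_1|q)}.$$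
   Context: Conventions: $0^0=1$. $[0]_q=0$, $[n]_q=1+q+\dots+q^{n-1}$ for $n\ge1$, $[n]_q!=\prod_{i=1}^n[i]_q$ with $[0]_q!=1$, and $\binom{n}{k}_q=\frac{[n]_q!}{[n-k]_q!\,[k]_q!}$ for $0\le k\le n$. The $q$-Pochhammer symbol is $(c;q)_n=\prod_{i=0}^{n-1}(1-cq^i)$, $(c;q)_0=1$, $(c;q)_\infty=\prod_{i\ge0}(1-cq^i)$. Big $q$-Hermite polynomials $H_n(x|a,q)$: $H_{-1}(x|a,q)=0$, $H_0(x|a,q)=1$, and for $n\ge0$ $$H_{n+1}(x|a,q)=(x-aq^n)H_n(x|a,q)-[n]_qH_{n-1}(x|a,q).$$ Al-Salam--Chihara polynomials $P_n(x|y,\rho,q)$: $P_0=1$, $P_1(x|y,\rho,q)=x-\rho y$, and for $n\ge1$ $$P_{n+1}(x|y,\rho,q)=(x-\rho yq^n)P_n(x|y,\rho,q)-[n]_q(1-\rho^2q^{n-1})P_{n-1}(x|y,\rho,q).$$ Polynomials $B_n(x|q)$: $B_0=1$, $B_1(x|q)=-x$, and for $n\ge1$ $$B_{n+1}(x|q)=-q^nxB_n(x|q)+q^{n-1}[n]_qB_{n-1}(x|q).$$ Further, $B_m(x|b,q)=\sum_{j=0}^m\binom{m}{j}_q b^{m-j}B_j(x|q)$. Finally $w(x,y,\rho|q)=(1-\rho^2)^2-(1-q)\rho(1+\rho^2)xy+(1-q)\rho^2(x^2+y^2)$. *)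

(* Defs.v *)
From HB Require Import structures.
From mathcomp Require Import all_boot all_order all_algebra.
From mathcomp Require Import all_classical all_reals all_analysis.
Set Implicit Arguments.
Unset Strict Implicit.
Unset Printing Implicit Defensive.
Import Order.TTheory GRing.Theory Num.Theory.
Import numFieldNormedType.Exports.
Local Open Scope classical_set_scope.
Local Open Scope ring_scope.

Definition qnum (R : fieldType) (q : R) (n : nat) : R := \sum_(i < n) q ^+ i.

Definition qfact (R : fieldType) (q : R) (n : nat) : R :=
  \prod_(1 <= i < n.+1) qnum q i.

Definition qbinom (R : fieldType) (q : R) (n k : nat) : R :=
  qfact q n / (qfact q (n - k) * qfact q k).

Definition qpoch (R : fieldType) (c q : R) (n : nat) : R :=
  \prod_(i < n) (1 - c * q ^+ i).

Definition qpoch_inf (R : realType) (c q : R) : R := limn (qpoch c q).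

(* The polynomials below are represented by their values at x.  In bigqH, the
   inner conditional encodes the convention H_{-1} = 0. *)
Fixpoint bigqH (R : fieldType) (n : nat) (x a q : R) : R :=
  if n is m.+1 then
    (x - a * q ^+ m) * bigqH m x a q
    - qnum q m * (if m is k.+1 then bigqH k x a q else 0)
  else 1.

Fixpoint ascP (R : fieldType) (n : nat) (x y rho q : R) : R :=
  match n with
  | 0%N => 1
  | 1%N => x - rho * y
  | (k.+1 as m).+1 =>
      (x - rho * y * q ^+ m) * ascP m x y rho q
      - qnum q m * (1 - rho ^+ 2 * q ^+ k) * ascP k x y rho q
  end.

Fixpoint polyB (R : fieldType) (n : nat) (x q : R) : R :=
  match n with
  | 0%N => 1
  | 1%N => - x
  | (k.+1 as m).+1 =>
      - q ^+ m * x * polyB m x q + q ^+ k * qnum q m * polyB k x q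
  end.

Definition bigB (R : fieldType) (m : nat) (x b q : R) : R :=
  \sum_(j < m.+1) qbinom q m j * b ^+ (m - j) * polyB j x q.

Definition w (R : fieldType) (x y rho q : R) : R :=
  (1 - rho ^+ 2) ^+ 2 - (1 - q) * rho * (1 + rho ^+ 2) * x * y
  + (1 - q) * rho ^+ 2 * (x ^+ 2 + y ^+ 2).

Definition suppS (R : realType) (q : R) : set R :=
  `[- 2 / Num.sqrt (1 - q), 2 / Num.sqrt (1 - q)]%classic.

Definition pprod (R : realType) (u : nat -> R) (n : nat) : R :=
  \prod_(k < n) u k.

(* Main.v *)
(* After rescaling by sqrt (1 - q), all three sums have the form
   F(z,s,t,p) = \sum_n Q_n Y_n / ((q;q)_n (p;q)_n), where Q and Y are
   Al-Salam--Chihara type sequences with Q_{n+1} = (x - s q^n) Q_n - ... and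
   Y_{n+1} = (z - s q^n) Y_n - ...  A telescoping certificate (in the style of
   q-Zeilberger) gives the first-order q-difference equation
     (1-p)(1-qp) W(x,z,t) F(z,s,t,p)
       = (1-t)(1-qt) W(x,s,p) F(qz,qs,q^2 t,q^2 p),
   with W = wred.  Iterating it, together with F(q^k z, q^k s, ...) -> 1, yields
   the product formula.  (i) is the case t = (a/b)^2, p = 0; (iii) is the case
   t = rho1^2, p = (rho1 rho2)^2; for (ii), the case t = 0, p = (a/b)^2 gives a
   product which is the reciprocal of the one in (i). *)
Require Import Defs.
From HB Require Import structures.
From mathcomp Require Import all_boot all_order all_algebra.
From mathcomp Require Import all_classical all_reals all_analysis.
From mathcomp Require Import ring lra.
Set Implicit Arguments.
Unset Strict Implicit.
Unset Printing Implicit Defensive.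
Import Order.TTheory GRing.Theory Num.Theory.
Import numFieldNormedType.Exports.
Local Open Scope classical_set_scope.
Local Open Scope ring_scope.

(** * A telescoping certificate *)

(* For t = 1 these are the Al-Salam--Chihara polynomials at z with s = a1 + a2
   and p = a1 * a2; the extra parameter t makes the family closed under
   multiplication by c^n and adds the limit case t = 0. *)
Fixpoint asc (R : fieldType) (z s t p q : R) (n : nat) : R :=
  match n with
  | 0%N => 1
  | 1%N => z - s
  | (k.+1 as m).+1 =>
      (z - s * q ^+ m) * asc z s t p q m
      - (1 - q ^+ m) * (t - p * q ^+ k) * asc z s t p q k
  end.

Lemma ascSS (R : fieldType) (z s t p q : R) n :
  asc z s t p q n.+2 = (z - s * q ^+ n.+1) * asc z s t p q n.+1
    - (1 - q ^+ n.+1) * (t - p * q ^+ n) * asc z s t p q n.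
Proof. by []. Qed.

Lemma nat_ind2 (P : nat -> Prop) : P 0%N -> P 1%N ->
  (forall n, P n -> P n.+1 -> P n.+2) -> forall n, P n.
Proof.
move=> P0 P1 PS n; suff: P n /\ P n.+1 by case.
by elim: n => // n [Pn PSn]; split=> //; exact: PS.
Qed.

(** Absorbs [a ^+ n / b ^+ n] and [rho1 ^+ n] into the parameters; with [c = q] it also produces the
    [q ^+ n] of [asc_summand]. *)
Lemma asc_scale (R : fieldType) (c z s t p q : R) n :
  asc (c * z) (c * s) (c ^+ 2 * t) (c ^+ 2 * p) q n = c ^+ n * asc z s t p q n.
Proof.
elim/nat_ind2: n => [||n IH0 IH1]; first by rewrite /= mul1r.
  by rewrite /= expr1; ring.
by rewrite !ascSS IH0 IH1 !exprS; ring.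
Qed.

(* Multiplying the generating function by (1 - a1 T)(1 - a2 T) amounts to
   replacing a1, a2 by q a1, q a2. *)
Lemma asc_contig (R : fieldType) (x s p q : R) n :
  let A := asc x (q * s) 1 (q ^+ 2 * p) q in
  asc x s 1 p q n.+2 = A n.+2 - s * (1 - q ^+ n.+2) * A n.+1
    + p * (1 - q ^+ n.+2) * (1 - q ^+ n.+1) * A n.
Proof.
move=> A; rewrite {}/A; elim/nat_ind2: n => [||n IH0 IH1].
- rewrite !ascSS /= !exprS !expr0; ring.
- rewrite !ascSS /= !exprS !expr0; ring.
rewrite ascSS IH0 IH1 !(ascSS x (q * s)).
move: (asc x _ _ _ _ n) (asc x _ _ _ _ n.+1) => a b.
rewrite !exprS; move: (q ^+ n) => T; ring.
Qed.

(** The lowest term of [asc_contig] is eliminated by the recurrence of A, at the price of the factor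
    on the left. The certificate then involves only two consecutive values of A. *)
Lemma asc_shift (R : fieldType) (x s p q : R) n :
  let A := asc x (q * s) 1 (q ^+ 2 * p) q in
  (1 - p * q ^+ n.+1) * asc x s 1 p q n.+1 =
  (1 - p) * A n.+1 + (1 - q ^+ n.+1) * (p * x - s) * A n.
Proof.
case: n => [|n] A; rewrite {}/A; first by rewrite /= !expr1; ring.
rewrite asc_contig !(ascSS x (q * s)).
move: (asc x _ _ _ _ n) (asc x _ _ _ _ n.+1) => a b.
rewrite !exprS; move: (q ^+ n) => T; ring.
Qed.

(* w x y c q is wred (u x) (c u y) (c^2) with u = sqrt (1 - q). *)
Definition wred (R : fieldType) (x z t : R) : R :=
  (1 - t) ^+ 2 - (1 + t) * x * z + t * x ^+ 2 + z ^+ 2.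

(* The coefficients were found by solving the linear system for a certificate
   bilinear in (u, v) and (f, h), with coefficients polynomial in q^n. *)
Definition asc_cert (R : fieldType) (x z s t p q : R) (n : nat) : R :=
  let u := asc x (q * s) 1 (q ^+ 2 * p) q n.+1 in
  let v := asc x (q * s) 1 (q ^+ 2 * p) q n in
  let f := asc z s t p q n.+1 in
  let h := asc z s t p q n in
  let T := q ^+ n.+1 in
  let d := t - p * q ^+ n in
  - ((1 - p) * (1 - t) - z * s + x * s * t + x * z * p - x ^+ 2 * p * t)
    * (u * f + (1 - T) * d * (v * h))
  + d * (x - x * p * t - s * (1 - t) - z * (1 - p)) * (u * h)
  + (s * (1 - t) + z * (1 - p) - x * (t + p - 2 * p * t) - x * z * s
     + x ^+ 2 * (s * t + z * p) - x ^+ 3 * p * t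
     + T * (- s * (1 - t) - z * p * (1 - p) + z * s ^+ 2 + x * p * (1 - p * t)
            - x * s ^+ 2 * t - x * z * s * p + x ^+ 2 * s * p * t))
    * (v * f).

(* Times 1 / ((q;q)_n (q^2 p;q)_n), this is the n-th term of the difference of
   the two sides of the q-difference equation. *)
Definition asc_summand (R : fieldType) (x z s t p q : R) (n : nat) : R :=
  (wred x z t * (1 - p * q ^+ n.+1) * ((1 - p * q ^+ n) * asc x s 1 p q n)
   - (1 - t) * (1 - q * t) * wred x s p * q ^+ n
     * asc x (q * s) 1 (q ^+ 2 * p) q n)
  * asc z s t p q n.

Lemma asc_cert0 (R : fieldType) (x z s t p q : R) :
  asc_cert x z s t p q 0 = asc_summand x z s t p q 0.
Proof. rewrite /asc_cert /asc_summand /wred /= !exprS !expr0. ring. Qed.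

(** Divided by (q;q)_{n+1} (q^2 p;q)_{n+1}, this is the telescoping step. Once all indices are
    lowered to n and n + 1, it is a polynomial identity in q^n and four free values. *)
Lemma asc_certS (R : fieldType) (x z s t p q : R) n :
  asc_cert x z s t p q n.+1 = asc_summand x z s t p q n.+1
   + (1 - q ^+ n.+1) * (1 - p * q ^+ n.+2) * asc_cert x z s t p q n.
Proof.
rewrite /asc_cert /asc_summand /wred asc_shift.
rewrite !(ascSS x (q * s)) !(ascSS z).
move: (asc x _ _ _ _ n) (asc x _ _ _ _ n.+1) => a b.
move: (asc z _ _ _ _ n) (asc z _ _ _ _ n.+1) => c d.
rewrite !exprS; move: (q ^+ n) => T. ring.
Qed.

(** * Identities for q-analogues, and reduction of H_n and P_n to [asc] *)

Lemma expX2 (R : comRingType) (q : R) k : q ^+ (2 * k) = (q ^+ k) ^+ 2.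
Proof. by rewrite mulnC exprM. Qed.

Lemma qpochS (R : fieldType) (c q : R) n :
  qpoch c q n.+1 = qpoch c q n * (1 - c * q ^+ n).
Proof. by rewrite /qpoch big_ord_recr. Qed.

Lemma qpochSl (R : fieldType) (c q : R) n :
  qpoch c q n.+1 = (1 - c) * qpoch (c * q) q n.
Proof.
rewrite /qpoch big_ord_recl expr0 mulr1; congr (_ * _).
by apply: eq_bigr => i _; rewrite /= /bump /= add1n exprS mulrA.
Qed.

(** Two factors of (p;q)_{n+2} are split off at its upper and at its lower end. This brings the
    series for p to the denominators of the one for q^2 p. *)
Lemma qpoch_shift2 (R : fieldType) (p q : R) n :
  (1 - p * q ^+ n) * (1 - p * q ^+ n.+1) * qpoch p q n
  = (1 - p) * (1 - q * p) * qpoch (q ^+ 2 * p) q n.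
Proof.
transitivity (qpoch p q n.+2); first by rewrite !qpochS; ring.
by rewrite !qpochSl !mulrA; congr (_ * _ * _ ); [ring| congr qpoch; ring].
Qed.

Lemma qnumE (R : fieldType) (q : R) n : (1 - q) * qnum q n = 1 - q ^+ n.
Proof. by rewrite -[RHS]opprB subrX1 -mulNr opprB. Qed.

Lemma qfactS (R : fieldType) (q : R) n :
  qfact q n.+1 = qfact q n * qnum q n.+1.
Proof. by rewrite /qfact big_nat_recr. Qed.

Lemma qfact0 (R : fieldType) (q : R) : qfact q 0 = 1.
Proof. by rewrite /qfact big_geq. Qed.

Lemma qfactE (R : fieldType) (q : R) n :
  (1 - q) ^+ n * qfact q n = qpoch q q n.
Proof.
elim: n => [|n IH]; first by rewrite qfact0 /qpoch big_ord0 mulr1.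
by rewrite qfactS qpochS -IH -exprS -qnumE exprS; ring.
Qed.

(** Scaling by u replaces [n]_q by u^2 [n]_q = 1 - q^n, the coefficient in [asc]. *)
Lemma bigqH_asc (R : fieldType) (u x a q : R) n : u ^+ 2 = 1 - q ->
  u ^+ n * bigqH n x a q = asc (u * x) (u * a) 1 0 q n.
Proof.
move=> hu; elim/nat_ind2: n => [||n IH0 IH1]; first by rewrite /= mulr1.
  by rewrite /= expr0; ring.
rewrite ascSS -IH0 -IH1 -qnumE -hu /=.
move: (match n with 0%N => _ | _ => _ end) => c.
by rewrite !exprS; ring.
Qed.

Lemma ascP_asc (R : fieldType) (u x y r q : R) n : u ^+ 2 = 1 - q ->
  u ^+ n * ascP n x y r q = asc (u * x) (u * (r * y)) 1 (r ^+ 2) q n.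
Proof.
move=> hu; elim/nat_ind2: n => [||n IH0 IH1]; first by rewrite /= mulr1.
  by rewrite /=; ring.
rewrite ascSS -IH0 -IH1 -qnumE -hu.
rewrite -[ascP n.+2 x y r q]/((x - r * y * q ^+ n.+1) * ascP n.+1 x y r q
      - qnum q n.+1 * (1 - r ^+ 2 * q ^+ n) * ascP n x y r q).
by rewrite !exprS; ring.
Qed.

Lemma polyBS (R : fieldType) (x q : R) n :
  polyB n.+2 x q = - q ^+ n.+1 * x * polyB n.+1 x q
    + q ^+ n * qnum q n.+1 * polyB n x q.
Proof. by []. Qed.

Lemma qbinom0 (R : fieldType) (q : R) n :
  (forall m, qfact q m != 0) -> qbinom q n 0 = 1.
Proof. by move=> h; rewrite /qbinom subn0 qfact0 mulr1 divff. Qed.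

Lemma qbinomnn (R : fieldType) (q : R) n :
  (forall m, qfact q m != 0) -> qbinom q n n = 1.
Proof. by move=> h; rewrite /qbinom subnn qfact0 mul1r divff. Qed.

Lemma qnumD (R : fieldType) (q : R) m n :
  qnum q (m + n) = qnum q m + q ^+ m * qnum q n.
Proof.
rewrite /qnum big_split_ord /=; congr (_ + _).
by rewrite big_distrr /=; apply: eq_bigr => i _; rewrite exprD.
Qed.

(** * Recurrence in n for bigB *)

Lemma qnum_neq0 (R : fieldType) (q : R) n :
  (forall m, qfact q m != 0) -> qnum q n.+1 != 0.
Proof. by move=> /(_ n.+1); rewrite qfactS mulf_eq0 negb_or => /andP[]. Qed.

Lemma qbinomS (R : fieldType) (q : R) n k :
  (forall m, qfact q m != 0) -> (k < n)%N ->
  qbinom q n.+1 k.+1 = qbinom q n k.+1 + q ^+ (n - k) * qbinom q n k.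
Proof.
move=> h kn; rewrite /qbinom subSS.
have -> : (n - k = (n - k.+1).+1)%N by rewrite subnSK.
have E : qnum q n.+1 = qnum q (n - k.+1).+1 + q ^+ (n - k.+1).+1 * qnum q k.+1.
  by rewrite -qnumD addSn subnK.
rewrite !qfactS E.
by field; rewrite !h !qnum_neq0.
Qed.

Lemma qbinom_absorb (R : fieldType) (q : R) n k :
  (forall m, qfact q m != 0) ->
  qbinom q n.+1 k.+1 * qnum q k.+1 = qnum q n.+1 * qbinom q n k.
Proof.
move=> h; rewrite /qbinom subSS !qfactS.
by field; rewrite !h !qnum_neq0.
Qed.

#[local] Arguments polyB : simpl never.

Lemma bigBS (R : fieldType) (y b q : R) n :
  (forall m, qfact q m != 0) ->
  bigB n.+1 y b q = b * bigB n y b q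
  + \sum_(j < n.+1) q ^+ (n - j) * qbinom q n j * b ^+ (n - j) * polyB j.+1 y q.
Proof.
move=> h; rewrite /bigB big_ord_recl qbinom0 // subn0 mul1r mulr1.
rewrite big_ord_recr lift0 qbinomnn // subnn expr0 !mul1r.
rewrite [X in _ + (X + _)](eq_bigr (fun j : 'I_n =>
    b * (qbinom q n j.+1 * b ^+ (n - j.+1) * polyB j.+1 y q)
    + q ^+ (n - j) * qbinom q n j * b ^+ (n - j) * polyB j.+1 y q)); last first.
  move=> j _; rewrite lift0 -[nat_of_ord (widen_ord _ _)]/(nat_of_ord j).
  by rewrite subSS qbinomS // -(subnSK (ltn_ord j)) !exprS; ring.
rewrite big_split -big_distrr [in RHS]big_ord_recl.
rewrite qbinom0 // subn0 mul1r mulr1 mulrDr -exprS.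
rewrite [in RHS]big_ord_recr subnn qbinomnn // !expr0 !mul1r.
under [in RHS]eq_bigr do rewrite lift0.
by rewrite !addrA.
Qed.

(** When [polyB j.+2] is expanded in the sum of [bigBS], the terms with y rebuild [bigB n.+1], and
    the others rebuild [bigB n] by [qbinom_absorb]. *)
Lemma bigBSS (R : fieldType) (y b q : R) n :
  (forall m, qfact q m != 0) ->
  bigB n.+2 y b q = (b - y * q ^+ n.+1) * bigB n.+1 y b q
    + qnum q n.+1 * q ^+ n * bigB n y b q.
Proof.
move=> h; rewrite bigBS // mulrBl -addrA; congr (_ + _).
rewrite big_ord_recl subn0.
have E (j : 'I_n.+1) : q ^+ (n.+1 - j.+1) * qbinom q n.+1 j.+1
      * b ^+ (n.+1 - j.+1) * polyB j.+2 y q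
    = - (y * q ^+ n.+1) * (qbinom q n.+1 j.+1 * b ^+ (n - j) * polyB j.+1 y q)
     + qnum q n.+1 * q ^+ n * (qbinom q n j * b ^+ (n - j) * polyB j y q).
  (* The powers q^(n-j) and q^j join to q^n, which leaves the sum over j. *)
  have hj : q ^+ n = q ^+ (n - j) * q ^+ j by rewrite -exprD subnK // -ltnS.
  rewrite subSS polyBS [q ^+ n.+1]exprS hj.
  transitivity (- (y * (q * (q ^+ (n - j) * q ^+ j)))
      * (qbinom q n.+1 j.+1 * b ^+ (n - j) * polyB j.+1 y q)
    + q ^+ (n - j) * q ^+ j * b ^+ (n - j) * polyB j y q
      * (qbinom q n.+1 j.+1 * qnum q j.+1)); first by rewrite exprS; ring.
  by rewrite qbinom_absorb //; ring.
under eq_bigr do rewrite lift0 E.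
rewrite big_split -!mulr_sumr /= /bigB [in RHS]big_ord_recl subn0 qbinom0 //.
under [in RHS]eq_bigr do rewrite lift0 subSS.
rewrite -[polyB ord0 y q]/1 -[polyB 1 y q]/(- y); ring.
Qed.

(** Read as a polynomial in b with y as shift, [bigB] falls under the limit case t = 0, because the
    last coefficient in [bigBSS] is + q^n [n+1]_q. *)
Lemma bigB_asc (R : fieldType) (u y b q : R) n : u ^+ 2 = 1 - q ->
  (forall m, qfact q m != 0) ->
  u ^+ n * bigB n y b q = asc (u * b) (u * y) 0 1 q n.
Proof.
move=> hu h; elim/nat_ind2: n => [||n IH0 IH1].
- by rewrite /bigB big_ord1 /polyB /= qbinom0 // !mulr1.
- rewrite /bigB big_ord_recl big_ord1 /= qbinom0 // qbinomnn // subn0 subnn.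
  by rewrite /polyB /= !expr1; ring.
by rewrite ascSS -IH0 -IH1 -qnumE -hu bigBSS // !exprS; ring.
Qed.

(** * Convergence of infinite products *)

(** Discrete Gronwall inequality: 1 + K e^k <= exp (K e^k), and the exponents add up to at most K /
    (1 - e). *)
Lemma gronwall (R : realType) (V : nat -> R) (r K e : R) :
  0 <= r -> 0 <= K -> 0 <= e < 1 -> (forall n, 0 <= V n) ->
  (forall n, V n.+1 <= r * (1 + K * e ^+ n) * V n) ->
  forall n, V n <= r ^+ n * expR (K / (1 - e)) * V 0%N.
Proof.
move=> r0 K0 /andP[e0 e1] V0 VS n.
have : V n <= r ^+ n * expR (K * qnum e n) * V 0%N.
  elim: n => [|n IH]; first by rewrite /qnum big_ord0 mulr0 expR0 !mul1r.
  apply: (le_trans (VS n)).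
  have h : qnum e n.+1 = qnum e n + e ^+ n by rewrite /qnum big_ord_recr.
  have -> : r ^+ n.+1 * expR (K * qnum e n.+1) * V 0%N
    = r * expR (K * e ^+ n) * (r ^+ n * expR (K * qnum e n) * V 0%N).
    by rewrite h mulrDr expRD exprS; ring.
  apply: ler_pM => //.
    by rewrite mulr_ge0 // addr_ge0 // mulr_ge0 // exprn_ge0.
  by rewrite ler_wpM2l // expR_ge1Dx.
move=> /le_trans; apply; rewrite ler_wpM2r // ler_wpM2l ?exprn_ge0 //.
rewrite ler_expR ler_wpM2l // -[leRHS]mul1r ler_pdivlMr ?subr_gt0 //.
by rewrite mulrC qnumE gerBl exprn_ge0.
Qed.

Lemma cvg_series_geo (R : realType) (d : nat -> R) (C r : R) :
  0 <= r < 1 -> (forall n, `|d n| <= C * r ^+ n) -> cvgn (series d).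
Proof.
move=> /andP[r0 r1] hd; apply: normed_cvg.
apply: (@series_le_cvg _ _ (geometric C r)) => //.
- by move=> n /=; exact: normr_ge0.
- by move=> n /=; apply: le_trans (hd n); exact: normr_ge0.
- by apply: is_cvg_geometric_series; rewrite ger0_norm.
Qed.

Lemma lim_series_geo (R : realType) (d : nat -> R) (C r : R) :
  0 <= r < 1 -> (forall n, `|d n| <= C * r ^+ n) ->
  `|limn (series d)| <= C / (1 - r).
Proof.
move=> /andP[r0 r1] hd.
have hr : `|r| < 1 by rewrite ger0_norm.
have hn : cvgn [normed series d].
  apply: (@series_le_cvg _ _ (geometric C r)) => //.
  + by move=> n /=; exact: normr_ge0.
  + by move=> n /=; apply: le_trans (hd n); exact: normr_ge0.
  + exact: is_cvg_geometric_series.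
apply: (le_trans (lim_series_norm hn)).
rewrite -(cvg_lim _ (@cvg_geometric_series R C r hr)) //.
by apply: lim_series_le => //; exact: is_cvg_geometric_series.
Qed.

(** By [gronwall] the partial products stay bounded, so the increments P_n (u_n - 1) decay
    geometrically. The limit may be zero. *)
Lemma cvg_prod_geo (R : realType) (P u : nat -> R) (K e : R) :
  0 <= K -> 0 <= e < 1 -> (forall n, P n.+1 = P n * u n) ->
  (forall n, `|u n - 1| <= K * e ^+ n) -> cvgn P.
Proof.
move=> K0 he PS hu; case/andP: (he) => e0 e1.
have hP n : `|P n| <= expR (K / (1 - e)) * `|P 0%N|.
  have := @gronwall R (fun n => `|P n|) 1 K e ler01 K0 he
    (fun n => normr_ge0 _) _ n.
  rewrite expr1n mul1r; apply => m; rewrite PS normrM mul1r mulrC ler_wpM2r //.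
  rewrite -[X in `|X|](subrK 1) addrC (le_trans (ler_normD _ _)) // normr1.
  by rewrite lerD2l.
have -> : P = (cst (P 0%N)) + series (telescope P).
  by apply/funext => n; rewrite [LHS]eq_sum_telescope.
apply: is_cvgD; first exact: is_cvg_cst.
apply: (@cvg_series_geo _ _ (expR (K / (1 - e)) * `|P 0%N| * K) e) => // n.
rewrite /telescope /= PS -[X in _ - X]mulr1 -mulrBr normrM -mulrA.
exact: ler_pM.
Qed.

(** * Bounds, convergence and positivity of q-Pochhammer symbols *)

Section qpoch.
Variables (R : realType) (q : R).
Hypothesis hq : `|q| < 1.

Let q01 : 0 <= `|q| < 1. Proof. by rewrite normr_ge0. Qed.

Lemma norm_expq_le1 n : `|q ^+ n| <= 1.
Proof. by rewrite normrX exprn_ile1 // ltW. Qed.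

Lemma norm_mulexp_le (c : R) n : `|c * q ^+ n| <= `|c|.
Proof. by rewrite normrM ler_piMr // norm_expq_le1. Qed.

Lemma qfac_gt0 (c : R) n : `|c| < 1 -> 0 < 1 - c * q ^+ n.
Proof.
move=> hc; rewrite subr_gt0; apply: le_lt_trans hc.
by rewrite (le_trans (ler_norm _)) // norm_mulexp_le.
Qed.

Lemma qpoch_gt0 (c : R) n : `|c| < 1 -> 0 < qpoch c q n.
Proof. by move=> hc; apply: prodr_gt0 => i _; exact: qfac_gt0. Qed.

Lemma qfacV_bound (c c0 : R) n : `|c| <= c0 -> c0 < 1 ->
  `|(1 - c * q ^+ n)^-1 - 1| <= (1 - c0)^-1 * `|q| ^+ n.
Proof.
move=> hc hc0; have hc1 := le_lt_trans hc hc0.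
have f0 := qfac_gt0 n hc1.
have -> : (1 - c * q ^+ n)^-1 - 1 = (1 - c * q ^+ n)^-1 * (c * q ^+ n).
  by field; rewrite gt_eqF.
rewrite normrM; apply: ler_pM => //.
  rewrite gtr0_norm ?invr_gt0 // lef_pV2 ?posrE ?f0 ?subr_gt0 //.
  rewrite lerD2l lerN2 (le_trans (ler_norm _)) //.
  exact: le_trans (norm_mulexp_le _ n) hc.
by rewrite normrM normrX ler_piMl ?exprn_ge0 // ltW.
Qed.

(** Using c0 instead of |c| makes the bound uniform in c; [term_bound] needs this for
    [c ^+ 2 * p]. *)
Lemma qpochV_bound (c c0 : R) n : `|c| <= c0 -> c0 < 1 ->
  (qpoch c q n)^-1 <= expR ((1 - c0)^-1 / (1 - `|q|)).
Proof.
move=> hc hc0; have hc1 := le_lt_trans hc hc0.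
have c00 : 0 <= (1 - c0)^-1 by rewrite invr_ge0 subr_ge0 ltW.
have := @gronwall R (fun n => (qpoch c q n)^-1) 1 _ _ ler01 c00 q01.
move=> /(_ _ _ n); rewrite expr1n mul1r /= [qpoch c q 0]big_ord0 invr1 mulr1.
apply=> m; first by rewrite invr_ge0 ltW // qpoch_gt0.
rewrite qpochS invfM mulrC mul1r.
apply: ler_wpM2r; first by rewrite invr_ge0 ltW // qpoch_gt0.
rewrite -lerBlDl (le_trans (ler_norm _)) //.
exact: qfacV_bound.
Qed.

Lemma cvg_qpoch (c : R) : `|c| < 1 -> cvgn (qpoch c q).
Proof.
move=> hc; apply: (@cvg_prod_geo _ _ (fun n => 1 - c * q ^+ n) `|c| `|q|) => //.
  by move=> n; exact: qpochS.
by move=> n; rewrite addrC addKr normrN normrM normrX.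
Qed.

Lemma cvg_qpochV (c : R) : `|c| < 1 -> cvgn (fun n => (qpoch c q n)^-1).
Proof.
move=> hc.
apply: (@cvg_prod_geo _ _ (fun n => (1 - c * q ^+ n)^-1) (1 - `|c|)^-1 `|q|) => //.
- by rewrite invr_ge0 subr_ge0 ltW.
- by move=> n; rewrite qpochS invfM.
- by move=> n; exact: qfacV_bound.
Qed.

(** The reciprocals converge too, by [cvg_qpochV]; a zero limit would make the constant sequence 1 =
    (c;q)_n / (c;q)_n tend to 0. *)
Lemma qpoch_inf_gt0 (c : R) : `|c| < 1 -> 0 < qpoch_inf c q.
Proof.
move=> hc; rewrite lt_neqAle; apply/andP; split; last first.
  apply: limr_ge; first exact: cvg_qpoch.
  by near=> n; rewrite ltW // qpoch_gt0.
apply/eqP => h0.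
have H : cst (1 : R) @ \oo --> (0 : R).
  have -> : cst (1 : R) = qpoch c q \* (fun n => (qpoch c q n)^-1).
    by apply/funext => n /=; rewrite divff // gt_eqF // qpoch_gt0.
  rewrite -(mul0r (limn (fun n => (qpoch c q n)^-1))) {1}h0.
  by apply: cvgM; [exact: cvg_qpoch | exact: cvg_qpochV].
have : lim (cst (1 : R) @ \oo) = 0 by exact: cvg_lim H.
by rewrite lim_cst // => /eqP; rewrite oner_eq0.
Unshelve. all: by end_near. Qed.

End qpoch.

(** * Growth of solutions of the recurrence *)

Section energy.
Variables (R : realType) (x : R).
Hypothesis hx : `|x| <= 2.

(* This quadratic form is invariant under the unperturbed recurrence
   (a, b) -> (x a - b, a), and is semidefinite (degenerate when x = 2 or -2). *)
Definition energy (a b : R) : R := a ^+ 2 - x * a * b + b ^+ 2.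

Lemma sqr_le4 : x ^+ 2 <= 4.
Proof.
have -> : 4 = 2 ^+ 2 :> R by rewrite expr2; lra.
by rewrite -real_normK ?num_real // lerXn2r ?nnegrE.
Qed.

Lemma sqr_le_energy a b : (a - x / 2 * b) ^+ 2 <= energy a b.
Proof.
have -> : energy a b = (a - x / 2 * b) ^+ 2 + (4 - x ^+ 2) / 4 * b ^+ 2.
  by rewrite /energy; field.
by rewrite lerDl mulr_ge0 ?sqr_ge0 // divr_ge0 // subr_ge0 sqr_le4.
Qed.

Lemma energy_ge0 a b : 0 <= energy a b.
Proof. exact: le_trans (sqr_ge0 _) (sqr_le_energy a b). Qed.

Lemma norm_le_energy a b : `|a - x / 2 * b| <= Num.sqrt (energy a b).
Proof. by rewrite -sqrtr_sqr ler_wsqrtr // sqr_le_energy. Qed.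

(** At |x| = 2 the energy controls only a - x b / 2, so |b| has to be added; its coefficient |x / 2|
    is at most 1. *)
Lemma norm_le_energyD a b : `|a| <= Num.sqrt (energy a b) + `|b|.
Proof.
rewrite -[X in `|X|](subrK (x / 2 * b)) (le_trans (ler_normD _ _)) //.
apply: lerD; first exact: norm_le_energy.
rewrite normrM ler_piMl // normrM normfV [`|2|]ger0_norm // ler_pdivrMr //.
by rewrite mul1r.
Qed.

(** The square root of a semidefinite form is a seminorm, and (f, 0) has length |f|. *)
Lemma sqrt_energyD a b f :
  Num.sqrt (energy (a + f) b) <= Num.sqrt (energy a b) + `|f|.
Proof.
have s0 := sqrtr_ge0 (energy a b).
rewrite -[leRHS]ger0_norm ?addr_ge0 // -sqrtr_sqr ler_wsqrtr //.
rewrite sqrrD sqr_sqrtr ?energy_ge0 // real_normK ?num_real //.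
have -> : energy (a + f) b = energy a b + (a - x / 2 * b) * f *+ 2 + f ^+ 2.
  by rewrite /energy; field.
rewrite lerD2r lerD2l lerMn2r /= (le_trans (ler_norm _)) // normrM.
by rewrite ler_wpM2r // norm_le_energy.
Qed.

Lemma energy_rot a b : energy (x * a - b) a = energy a b.
Proof. by rewrite /energy; ring. Qed.

End energy.

Lemma norm_expqS (R : realType) (q : R) n :
  `|q| < 1 -> `|q ^+ n.+1| <= `|q| ^+ n.
Proof.
by move=> hq; rewrite normrX exprS ler_piMl ?exprn_ge0 // ltW.
Qed.

(** For t = 1 the recurrence is (a, b) -> (x a - b, a) up to an error of order |q|^n. The degenerate
    energy at |x| = 2 allows linear growth, hence the factor (1 + d)^n. C is uniform in s and p, as
    [term_bound] needs for c s and c^2 p. *)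
Lemma asc_growth (R : realType) (x q M d : R) :
  `|q| < 1 -> `|x| <= 2 -> 0 <= M -> 0 < d ->
  exists2 C, 0 <= C & forall (s p : R) n, `|s| <= M -> `|p| <= M ->
    `|asc x s 1 p q n| <= C * (1 + d) ^+ n.
Proof.
move=> hq hx M0 d0.
(* In K, (1 + 2 M) |q|^m bounds the coefficients of the error f, and 1 + 2 / d comes from e + 2 |Q|
   <= (1 + 2 / d) V. *)
pose K := (1 + 2 * M) * (1 + 2 / d).
have K0 : 0 <= K.
  by rewrite mulr_ge0 // addr_ge0 // ?mulr_ge0 // invr_ge0 ltW.
exists (expR (K / (1 - `|q|)) * (1 + M + d) / d).
  apply: divr_ge0; last exact: ltW.
  by rewrite mulr_ge0 ?expR_ge0 // !addr_ge0 // ltW.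
move=> s p n hs hp.
pose Q := asc x s 1 p q.
pose e m := Num.sqrt (energy x (Q m.+1) (Q m)).
(* Since |Q_{m+1}| <= e_m + |Q_m|, the weight d makes V grow by a factor of at most 1 + d when the
   error is left aside. *)
pose V m := e m + d * `|Q m|.
have e0 m : 0 <= e m by exact: sqrtr_ge0.
have V0 m : 0 <= V m by rewrite addr_ge0 // mulr_ge0 // ltW.
have VS m : V m.+1 <= (1 + d) * (1 + K * `|q| ^+ m) * V m.
  pose f := - (s * q ^+ m.+1) * Q m.+1
    + (q ^+ m.+1 + p * q ^+ m - p * (q ^+ m * q ^+ m.+1)) * Q m.
  have QE : Q m.+2 = (x * Q m.+1 - Q m) + f by rewrite /f /Q ascSS; ring.
  set T := `|q| ^+ m.
  have T0 : 0 <= T by rewrite exprn_ge0.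
  have hf : `|f| <= (1 + 2 * M) * T * (e m + 2 * `|Q m|).
    have h1 : `|s * q ^+ m.+1| <= M * T.
      by rewrite normrM ler_pM // norm_expqS.
    have h2 : `|q ^+ m.+1 + p * q ^+ m - p * (q ^+ m * q ^+ m.+1)|
        <= (1 + 2 * M) * T.
      have g1 : `|q ^+ m.+1| <= T by exact: norm_expqS.
      have g2 : `|p * q ^+ m| <= M * T by rewrite normrM normrX ler_wpM2r.
      have g3 : `|p * (q ^+ m * q ^+ m.+1)| <= M * T.
        by rewrite mulrA normrM (le_trans _ g2) // ler_piMr // norm_expq_le1.
      apply: (le_trans (ler_normB _ _)); apply: (le_trans (lerD _ g3)).
        by apply: (le_trans (ler_normD _ _)); apply: (lerD g1 g2).
      by lra.
    have h3 : `|Q m.+1| <= e m + `|Q m| by exact: norm_le_energyD.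
    apply: (le_trans (ler_normD _ _)); rewrite !normrM normrN.
    have h4 : `|s * q ^+ m.+1| * `|Q m.+1| <= (1 + 2 * M) * T * (e m + `|Q m|).
      by apply: ler_pM => //; apply: (le_trans h1); rewrite ler_wpM2r //; lra.
    have h5 := ler_wpM2r (normr_ge0 (Q m)) h2.
    apply: (le_trans (lerD h4 h5)).
    have -> : 2 * `|Q m| = `|Q m| + `|Q m| by ring.
    by rewrite -mulrDr addrA.
  have h6 : e m.+1 <= e m + `|f|.
    rewrite /e QE (le_trans (sqrt_energyD hx _ _ _)) // energy_rot //.
  have h7 : `|Q m.+1| <= e m + `|Q m| by exact: norm_le_energyD.
  have h8 : (1 + 2 * M) * T * (e m + 2 * `|Q m|) <= K * T * V m.
    have -> : K * T * V m = (1 + 2 * M) * T * ((1 + 2 / d) * V m).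
      by rewrite /K; ring.
    apply: ler_wpM2l; first by rewrite mulr_ge0 // addr_ge0 // mulr_ge0.
    have -> : (1 + 2 / d) * V m = e m + 2 * `|Q m| + (d * `|Q m| + 2 / d * e m).
      by rewrite /V; field; rewrite gt_eqF.
    by rewrite lerDl addr_ge0 // mulr_ge0 // ?divr_ge0 // ltW.
  have h9 : K * T * V m <= (1 + d) * (K * T * V m).
    by rewrite ler_peMl // ?(mulr_ge0 (mulr_ge0 K0 T0)) // lerDl ltW.
  have h10 : d * `|Q m.+1| <= d * (e m + `|Q m|) by rewrite ler_wpM2l // ltW.
  have -> : (1 + d) * (1 + K * T) * V m = (1 + d) * V m + (1 + d) * (K * T * V m).
    by ring.
  have h11 : 0 <= d * (d * `|Q m|) by rewrite !mulr_ge0 // ltW.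
  rewrite {1}/V.
  have -> : (1 + d) * V m = e m + d * (e m + `|Q m|) + d * (d * `|Q m|).
    by rewrite /V; ring.
  lra.
have d1 : 0 <= 1 + d by rewrite addr_ge0 // ltW.
have q01 : 0 <= `|q| < 1 by rewrite normr_ge0.
have VN := gronwall d1 K0 q01 V0 VS n.
have VI : V 0%N <= 1 + M + d.
  rewrite /V /= normr1 mulr1 lerD2r /e /Q /= -[leRHS]ger0_norm ?addr_ge0 //.
  rewrite -sqrtr_sqr ler_wsqrtr // /energy.
  have -> : (x - s) ^+ 2 - x * (x - s) * 1 + 1 ^+ 2 = s ^+ 2 - x * s + 1 by ring.
  have -> : (1 + M) ^+ 2 = M ^+ 2 + 2 * M + 1 by ring.
  rewrite lerD2r; apply: lerD.
    by rewrite -real_normK ?num_real // lerXn2r ?nnegrE.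
  by rewrite (le_trans (ler_norm _)) // normrN normrM ler_pM.
have QV : `|Q n| * d <= V n by rewrite mulrC lerDr.
rewrite -/(Q n) -(ler_pM2r d0); apply: (le_trans QV); apply: (le_trans VN).
have -> : expR (K / (1 - `|q|)) * (1 + M + d) / d * (1 + d) ^+ n * d
  = (1 + d) ^+ n * expR (K / (1 - `|q|)) * (1 + M + d).
  by field; rewrite gt_eqF.
by rewrite ler_wpM2l // mulr_ge0 ?exprn_ge0 ?expR_ge0.
Qed.

(** For t = 0 all coefficients other than z decay like |q|^n, so Y_{n+1} is close to z Y_n and any
    rate r > |z| will do. *)
Lemma asc0_growth (R : realType) (z s p q r : R) :
  `|q| < 1 -> `|z| < r ->
  exists C, forall n, `|asc z s 0 p q n| <= C * r ^+ n.
Proof.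
move=> hq hz; have r0 : 0 < r := le_lt_trans (normr_ge0 z) hz.
(* The gap k weights the older value in V, as |z| |Y_{m+1}| + k |Y_{m+1}| = r |Y_{m+1}|. *)
pose k := r - `|z|; have k0 : 0 < k by rewrite subr_gt0.
pose L := `|s| + 2 * `|p|.
have L0 : 0 <= L by rewrite addr_ge0 // mulr_ge0.
pose K := L * (1 + k^-1) / r.
have K0 : 0 <= K by rewrite !mulr_ge0 // ?addr_ge0 // invr_ge0 ltW.
pose Y := asc z s 0 p q.
pose V m := `|Y m.+1| + k * `|Y m|.
have V0 m : 0 <= V m by rewrite addr_ge0 // mulr_ge0 // ltW.
have VS m : V m.+1 <= r * (1 + K * `|q| ^+ m) * V m.
  set T := `|q| ^+ m.
  have T0 : 0 <= T by rewrite exprn_ge0.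
  have h1 : `|s * q ^+ m.+1| <= `|s| * T.
    by rewrite normrM ler_wpM2l // norm_expqS.
  have h2 : `|(1 - q ^+ m.+1) * (0 - p * q ^+ m)| <= 2 * `|p| * T.
    rewrite sub0r normrM normrN normrM normrX -/T -mulrA ler_wpM2r ?mulr_ge0 //.
    apply: (le_trans (ler_normB _ _)).
    by have := norm_expq_le1 hq m.+1; rewrite normr1; lra.
  have h3 : `|Y m.+2| <= `|z| * `|Y m.+1| + L * T * (`|Y m.+1| + `|Y m|).
    rewrite /Y ascSS; apply: (le_trans (ler_normB _ _)).
    rewrite mulrBl.
    apply: (le_trans (lerD (ler_normB _ _) (lexx _))).
    rewrite [X in X + _ + _]normrM -addrA lerD2l.
    rewrite normrM [X in _ + X]normrM -/Y.
    have g1 := ler_wpM2r (normr_ge0 (Y m.+1)) h1.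
    have g2 := ler_wpM2r (normr_ge0 (Y m)) h2.
    apply: (le_trans (lerD g1 g2)).
    rewrite -subr_ge0 /L.
    have -> : (`|s| + 2 * `|p|) * T * (`|Y m.+1| + `|Y m|) -
       (`|s| * T * `|Y m.+1| + 2 * `|p| * T * `|Y m|)
       = `|s| * T * `|Y m| + 2 * `|p| * T * `|Y m.+1| by ring.
    by rewrite addr_ge0 // !mulr_ge0.
  have h4 : r * (1 + K * T) * V m = r * V m + L * T * ((1 + k^-1) * V m).
    by rewrite /K; field; rewrite !gt_eqF.
  have h5 : L * T * (`|Y m.+1| + `|Y m|) <= L * T * ((1 + k^-1) * V m).
    apply: ler_wpM2l; first by rewrite mulr_ge0.
    have -> : (1 + k^-1) * V m
       = `|Y m.+1| + `|Y m| + (k * `|Y m| + k^-1 * `|Y m.+1|).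
      by rewrite /V; field; rewrite !gt_eqF.
    by rewrite lerDl addr_ge0 // mulr_ge0 // ?invr_ge0 // ltW.
  have h6 : 0 <= r * (k * `|Y m|) by rewrite !mulr_ge0 // ltW.
  rewrite h4 {1}/V.
  have -> : r * V m = `|z| * `|Y m.+1| + k * `|Y m.+1| + r * (k * `|Y m|).
    by rewrite /V /k; ring.
  lra.
have q01 : 0 <= `|q| < 1 by rewrite normr_ge0.
exists (expR (K / (1 - `|q|)) * V 0%N / k) => n.
have VN := gronwall (ltW r0) K0 q01 V0 VS n.
have YV : `|Y n| * k <= V n by rewrite mulrC lerDr.
rewrite -/(Y n) -(ler_pM2r k0); apply: (le_trans YV); apply: (le_trans VN).
by rewrite le_eqVlt; apply/orP; left; apply/eqP; field; rewrite !gt_eqF.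
Qed.

(** * The q-difference equation *)

Definition asc_term (R : fieldType) (x z s t p q : R) (n : nat) : R :=
  asc x s 1 p q n * asc z s t p q n / (qpoch q q n * qpoch p q n).

(** [qpoch_shift2] puts each difference over (q;q)_k (q^2 p;q)_k with numerator [asc_summand];
    [asc_cert0] and [asc_certS] then drive the induction. *)
Lemma term_telescope (R : fieldType) (x z s t p q : R) n :
  (forall m, qpoch q q m != 0) -> (forall m, qpoch p q m != 0) ->
  \sum_(k < n.+1) (wred x z t * ((1 - p) * (1 - q * p)) * asc_term x z s t p q k
    - (1 - t) * (1 - q * t) * wred x s p
      * asc_term x (q * z) (q * s) (q ^+ 2 * t) (q ^+ 2 * p) q k)
  = asc_cert x z s t p q n / (qpoch q q n * qpoch (q ^+ 2 * p) q n).
Proof.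
move=> hq hp.
have p1 : 1 - p != 0 by have := hp 1%N; rewrite qpochS /qpoch big_ord0 mul1r mulr1.
have p2 : 1 - q * p != 0.
  by have := hp 2; rewrite !qpochS mulf_eq0 negb_or expr1 [p * q]mulrC => /andP[].
have hp' m : qpoch (q ^+ 2 * p) q m != 0.
  have := hp m.+2; rewrite !qpochSl !mulf_eq0 !negb_or => /and3P[_ _].
  by congr (qpoch _ _ _ != 0); ring.
have E k : wred x z t * ((1 - p) * (1 - q * p)) * asc_term x z s t p q k
    - (1 - t) * (1 - q * t) * wred x s p
      * asc_term x (q * z) (q * s) (q ^+ 2 * t) (q ^+ 2 * p) q k
    = asc_summand x z s t p q k / (qpoch q q k * qpoch (q ^+ 2 * p) q k).
  rewrite /asc_term asc_scale.
  have -> : asc x s 1 p q k * asc z s t p q k / (qpoch q q k * qpoch p q k)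
    = (1 - p * q ^+ k) * (1 - p * q ^+ k.+1) / ((1 - p) * (1 - q * p))
      * (asc x s 1 p q k * asc z s t p q k)
      / (qpoch q q k * qpoch (q ^+ 2 * p) q k).
    have h := qpoch_shift2 p q k.
    have -> : qpoch (q ^+ 2 * p) q k = (1 - p * q ^+ k) * (1 - p * q ^+ k.+1)
       * qpoch p q k / ((1 - p) * (1 - q * p)).
      by rewrite h; field; rewrite p1 p2.
    have h1 : 1 - p * q ^+ k != 0.
      by have := hp k.+1; rewrite qpochS mulf_eq0 negb_or => /andP[].
    have h2 : 1 - p * q ^+ k.+1 != 0.
      by have := hp k.+2; rewrite qpochS mulf_eq0 negb_or => /andP[].
    move: (q ^+ k.+1) h2 h1 => T h2; move: (q ^+ k) => T' h1.
    by field; rewrite hq hp p1 p2 h1 h2.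
  rewrite /asc_summand; move: (q ^+ k.+1) => T; move: (q ^+ k) => T'.
  by field; rewrite hq hp' p1 p2.
elim: n => [|n IH].
  by rewrite big_ord1 E asc_cert0.
rewrite big_ord_recr IH /= E asc_certS [qpoch q q n.+1]qpochS.
rewrite [qpoch (_ * _) _ n.+1]qpochS.
have h1 : 1 - q * q ^+ n != 0.
  by have := hq n.+1; rewrite qpochS mulf_eq0 negb_or => /andP[].
have h2 : 1 - q ^+ 2 * p * q ^+ n != 0.
  by have := hp' n.+1; rewrite qpochS mulf_eq0 negb_or => /andP[].
have -> : 1 - p * q ^+ n.+2 = 1 - q ^+ 2 * p * q ^+ n by rewrite !exprS; ring.
rewrite [q ^+ n.+1]exprS.
move: (asc_summand _ _ _ _ _ _ _) (asc_cert _ _ _ _ _ _ _) => a b.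
move: (hq n) (hp' n) h1 h2; move: (qpoch q q n) (qpoch _ q n) => c d.
move: (q ^+ n) => T c0 d0 h1 h2.
by field; rewrite c0 d0 h1 h2.
Qed.

Lemma cvg0_geo (R : realType) (d : nat -> R) (C r : R) :
  0 <= r < 1 -> (forall n, `|d n| <= C * r ^+ n) -> d @ \oo --> 0.
Proof. by move=> hr hd; apply: cvg_series_cvg_0; exact: cvg_series_geo hr hd. Qed.

(** * Convergence of the series and its functional equation *)

Section master.
Variables (R : realType) (q x z s t p r C0 : R).
Hypothesis hq : `|q| < 1.
Hypothesis hx : `|x| <= 2.
Hypothesis hp : `|p| < 1.
Hypothesis ht : `|t| < 1.
Hypothesis hr : 0 <= r < 1.
Hypothesis hY : forall n, `|asc z s t p q n| <= C0 * r ^+ n.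

(** The decay rate of a product: [asc_growth] with d = 1 - r gives (2 - r)^n, [hY] gives r^n, and (2
    - r) r = 1 - (1 - r)^2 < 1. *)
Let r' := (2 - r) * r.
Let r'01 : 0 <= r' < 1.
Proof.
case/andP: hr => r0 r1; rewrite /r' mulr_ge0 ?subr_ge0 //=; last lra.
have : 0 < (1 - r) ^+ 2 by rewrite exprn_gt0 // subr_gt0.
by rewrite expr2; lra.
Qed.

Lemma norm_scale_le (c y : R) : `|c| <= 1 -> `|c * y| <= `|y|.
Proof. by move=> hc; rewrite normrM ler_piMl. Qed.

Lemma norm_scale2_le (c y : R) : `|c| <= 1 -> `|c ^+ 2 * y| <= `|y|.
Proof.
by move=> hc; rewrite norm_scale_le // normrX exprn_ile1.
Qed.

(** The factor |c|^n, which comes from [asc_scale], makes all terms with n > 0 vanish as c tends to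
    0. *)
Lemma term_bound : exists2 C, 0 <= C & forall (c : R) n, `|c| <= 1 ->
  `|asc_term x (c * z) (c * s) (c ^+ 2 * t) (c ^+ 2 * p) q n|
  <= C * `|c| ^+ n * r' ^+ n.
Proof.
case/andP: hr => r0 r1.
have r1' : 0 < 1 - r by rewrite subr_gt0.
have [C1 C10 hQ] := @asc_growth R x q (`|s| + `|p|) (1 - r) hq hx
  (addr_ge0 (normr_ge0 _) (normr_ge0 _)) r1'.
pose D1 := expR ((1 - `|q|)^-1 / (1 - `|q|)).
pose D2 := expR ((1 - `|p|)^-1 / (1 - `|q|)).
have C00 : 0 <= C0 by have := hY 0; rewrite expr0 mulr1; exact: le_trans.
exists (C1 * C0 * (D1 * D2)); first by rewrite !mulr_ge0 // expR_ge0.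
move=> c n hc; rewrite /asc_term asc_scale.
have hcp := norm_scale2_le p hc.
have hs' : `|c * s| <= `|s| + `|p|.
  by rewrite (le_trans (norm_scale_le _ hc)) // lerDl.
have hp' : `|c ^+ 2 * p| <= `|s| + `|p| by rewrite (le_trans hcp) // lerDr.
have b1 := hQ _ _ n hs' hp'.
have b2 := hY n.
have b3 : (qpoch q q n)^-1 <= D1 by exact: qpochV_bound.
have b4 : (qpoch (c ^+ 2 * p) q n)^-1 <= D2 by exact: qpochV_bound.
have q3 := qpoch_gt0 hq n hq.
have q4 := qpoch_gt0 hq n (le_lt_trans hcp hp).
have -> : C1 * C0 * (D1 * D2) * `|c| ^+ n * r' ^+ n =
   (C1 * (1 + (1 - r)) ^+ n) * (`|c| ^+ n * (C0 * r ^+ n)) * (D1 * D2).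
  by rewrite /r' exprMn (_ : 1 + (1 - r) = 2 - r); ring.
rewrite normrM; apply: ler_pM => //.
  rewrite normrM; apply: ler_pM => //.
  by rewrite normrM normrX ler_wpM2l // exprn_ge0.
rewrite invfM normrM; apply: ler_pM => //.
  by rewrite gtr0_norm // invr_gt0.
by rewrite gtr0_norm // invr_gt0.
Qed.

Lemma cvg_term (c : R) : `|c| <= 1 ->
  cvgn (series (asc_term x (c * z) (c * s) (c ^+ 2 * t) (c ^+ 2 * p) q)).
Proof.
move=> hc; have [C CC0 hC] := term_bound.
apply: (@cvg_series_geo _ _ C r') => // n.
apply: (le_trans (hC c n hc)); rewrite ler_wpM2r ?exprn_ge0 //.
  by case/andP: r'01.
by rewrite ler_piMr // exprn_ile1.
Qed.

Definition Fsum (c : R) : R :=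
  limn (series (asc_term x (c * z) (c * s) (c ^+ 2 * t) (c ^+ 2 * p) q)).

(** The term with n = 0 is 1, and by [term_bound] the others add up to O(|q|^k). *)
Lemma Fsum_cvg1 : Fsum (q ^+ k) @[k --> \oo] --> (1 : R).
Proof.
have [C CC0 hC] := term_bound.
have H k : `|1 - Fsum (q ^+ k)| <= C / (1 - r') * `|q| ^+ k.
  have hc := norm_expq_le1 hq k.
  pose T := asc_term x (q ^+ k * z) (q ^+ k * s) ((q ^+ k) ^+ 2 * t)
    ((q ^+ k) ^+ 2 * p) q.
  pose dl : nat -> R := fun n => (n == 0%N)%:R.
  have dlE n : series dl n.+1 = 1.
    rewrite /series /= big_nat_recl // /dl /= big1 ?addr0 // => i _.
  have dl1 : series dl @ \oo --> (1 : R).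
    by rewrite -cvg_shiftS; apply: cvg_near_cst; near=> n; exact: dlE.
  have cT : cvgn (series T) by exact: cvg_term.
  have -> : 1 - Fsum (q ^+ k) = - limn (series (T - dl)).
    rewrite lim_seriesB //; last by apply/cvg_ex; exists 1.
    by rewrite (cvg_lim _ dl1) // opprB.
  rewrite normrN mulrAC; apply: lim_series_geo => // -[|n].
    have -> : (T - dl) 0%N = 0.
      by rewrite /T /dl /asc_term !fctE /= /qpoch !big_ord0 !mul1r invr1 subrr.
    by rewrite normr0 !mulr_ge0 // exprn_ge0.
  have -> : (T - dl) n.+1 = T n.+1 by rewrite /dl !fctE /= subr0.
  apply: (le_trans (hC _ n.+1 hc)); rewrite ler_wpM2r ?exprn_ge0 //.
    by case/andP: r'01.
  rewrite ler_wpM2l // normrX exprS ler_piMr ?exprn_ge0 //.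
  by rewrite exprn_ile1 // exprn_ile1 // ltW.
have {}H := cvg0_geo (_ : 0 <= `|q| < 1) H.
have -> : (fun k => Fsum (q ^+ k)) = (fun k => 1 - (1 - Fsum (q ^+ k))).
  by apply/funext => k; rewrite opprB addrC subrK.
rewrite -[X in _ --> X]subr0; apply: cvgB; first exact: cvg_cst.
by apply: H; rewrite normr_ge0.
Unshelve. all: by end_near. Qed.

(** The certificate is bilinear in (A_n, A_{n+1}) and (Y_n, Y_{n+1}) with convergent coefficients,
    and every product A Y is O(r'^n). *)
Lemma asc_cert_cvg0 :
  (fun n => asc_cert x z s t p q n / (qpoch q q n * qpoch (q ^+ 2 * p) q n))
    @ \oo --> (0 : R).
Proof.
case/andP: hr => r0 r1.
have r1' : 0 < 1 - r by rewrite subr_gt0.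
have [C1 C10 hQ] := @asc_growth R x q (`|s| + `|p|) (1 - r) hq hx
  (addr_ge0 (normr_ge0 _) (normr_ge0 _)) r1'.
have C00 : 0 <= C0 by have := hY 0; rewrite expr0 mulr1; exact: le_trans.
pose A := asc x (q * s) 1 (q ^+ 2 * p) q.
pose Y := asc z s t p q.
have q1 : `|q| <= 1 by exact: ltW.
have hA n : `|A n| <= C1 * (2 - r) ^+ n.
  rewrite (_ : 2 - r = 1 + (1 - r)); last by ring.
  apply: hQ; first by rewrite (le_trans (norm_scale_le _ q1)) // lerDl.
  by rewrite (le_trans (norm_scale2_le _ q1)) // lerDr.
(* Booleans serve as the shifts 0 and 1, which covers four products at once. *)
have hb (i j : bool) : (fun n => A (n + i)%N * Y (n + j)%N) @ \oo --> (0 : R).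
  apply: (@cvg0_geo _ _ (C1 * C0 * 2) r') => // n.
  rewrite normrM (le_trans (ler_pM _ _ (hA _) (hY _))) //.
  have -> : C1 * (2 - r) ^+ (n + i) * (C0 * r ^+ (n + j))
    = C1 * C0 * r' ^+ n * ((2 - r) ^+ i * r ^+ j).
    by rewrite /r' exprMn !exprD; ring.
  rewrite [leRHS]mulrAC ler_wpM2l //.
    by rewrite !mulr_ge0 // exprn_ge0 //; case/andP: r'01.
  have r2 : 0 <= 2 - r by lra.
  rewrite -[leRHS]mulr1; apply: ler_pM; rewrite ?exprn_ge0 //.
    by case: i; rewrite ?expr0 ?expr1; lra.
  by rewrite exprn_ile1 // ltW.
have hT : (fun n => q ^+ n.+1) @ \oo --> (0 : R).
  by rewrite cvg_shiftS; exact: cvg_expr.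
have hd : (fun n => t - p * q ^+ n) @ \oo --> t - p * 0.
  apply: cvgB; first exact: cvg_cst.
  by apply: cvgM; [exact: cvg_cst | exact: cvg_expr].
have hq2p : `|q ^+ 2 * p| < 1.
  exact: le_lt_trans (norm_scale2_le _ q1) hp.
have hD : cvgn (fun n => (qpoch q q n * qpoch (q ^+ 2 * p) q n)^-1).
  under eq_fun do rewrite invfM.
  by apply: is_cvgM; exact: cvg_qpochV.
rewrite -(mul0r (limn (fun n => (qpoch q q n * qpoch (q ^+ 2 * p) q n)^-1))).
apply: cvgM => //.
have hu := hb true true; have hv := hb false false.
have hw := hb true false; have ho := hb false true.
pose E := - ((1 - p) * (1 - t) - z * s + x * s * t + x * z * p - x ^+ 2 * p * t).
pose c1 := x - x * p * t - s * (1 - t) - z * (1 - p).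
pose c2 := s * (1 - t) + z * (1 - p) - x * (t + p - 2 * p * t) - x * z * s
     + x ^+ 2 * (s * t + z * p) - x ^+ 3 * p * t.
pose c3 := - s * (1 - t) - z * p * (1 - p) + z * s ^+ 2 + x * p * (1 - p * t)
            - x * s ^+ 2 * t - x * z * s * p + x ^+ 2 * s * p * t.
have -> : asc_cert x z s t p q = fun n =>
   E * (A (n + true)%N * Y (n + true)%N
     + (1 - q ^+ n.+1) * (t - p * q ^+ n) * (A (n + false)%N * Y (n + false)%N))
   + (t - p * q ^+ n) * c1 * (A (n + true)%N * Y (n + false)%N)
   + (c2 + q ^+ n.+1 * c3) * (A (n + false)%N * Y (n + true)%N).
  by apply/funext => n; rewrite !addn1 !addn0.
(* Zero is written in the shape of the certificate, so that the limit rules apply term by term. *)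
have -> : 0 = E * (0 + (1 - 0) * (t - p * 0) * 0) + (t - p * 0) * c1 * 0
   + (c2 + 0 * c3) * 0 by ring.
have hc (a : R) : (fun=> a) @ \oo --> a by exact: cvg_cst.
apply: cvgD; last by apply: cvgM => //; apply: cvgD => //; exact: cvgM.
apply: cvgD; last by apply: cvgM => //; exact: cvgM.
apply: cvgM => //; apply: cvgD => //; apply: cvgM => //; apply: cvgM => //.
exact: cvgB.
Qed.

Lemma cvg_term1 : cvgn (series (asc_term x z s t p q)).
Proof.
by have := @cvg_term 1; rewrite normr1 expr1n !mul1r; apply.
Qed.

Lemma functional_eq :
  wred x z t * ((1 - p) * (1 - q * p)) * limn (series (asc_term x z s t p q))
  = (1 - t) * (1 - q * t) * wred x s p
    * limn (series (asc_term x (q * z) (q * s) (q ^+ 2 * t) (q ^+ 2 * p) q)).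
Proof.
set a := wred x z t * _; set b := _ * wred x s p.
have c1 := cvg_term1; have c2 := cvg_term (ltW hq).
apply/eqP; rewrite -subr_eq0; apply/eqP.
(* Partial sums are shifted to n + 1, since [term_telescope] sums the indices 0 to n. *)
rewrite -[LHS](_ : limn (fun n => a * series (asc_term x z s t p q) n.+1 - b *
    series (asc_term x (q * z) (q * s) (q ^+ 2 * t) (q ^+ 2 * p) q) n.+1) = _).
  apply: cvg_lim => //.
  rewrite (_ : (fun n => _) = (fun n => asc_cert x z s t p q n
      / (qpoch q q n * qpoch (q ^+ 2 * p) q n))); first exact: asc_cert_cvg0.
  apply/funext => n; rewrite -term_telescope.
  - by rewrite sumrB -!mulr_sumr /series /= !big_mkord.
  - by move=> m; rewrite gt_eqF // qpoch_gt0.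
  - by move=> m; rewrite gt_eqF // qpoch_gt0.
apply: cvg_lim => //; apply: cvgB; apply: cvgM; try exact: cvg_cst.
  by rewrite (cvg_shiftS (series _)).
by rewrite (cvg_shiftS (series _)).
Qed.

End master.

(** * Iteration of the functional equation *)

Section product_formula.
Variables (R : realType) (q x z s t p r C0 : R).
Hypothesis hq : `|q| < 1.
Hypothesis hx : `|x| <= 2.
Hypothesis hp : `|p| < 1.
Hypothesis ht : `|t| < 1.
Hypothesis hr : 0 <= r < 1.
Hypothesis hY : forall n, `|asc z s t p q n| <= C0 * r ^+ n.
Hypothesis hW : forall k, wred x (q ^+ k * z) ((q ^+ k) ^+ 2 * t) != 0.

Let ratio k := wred x (q ^+ k * s) ((q ^+ k) ^+ 2 * p)
  / wred x (q ^+ k * z) ((q ^+ k) ^+ 2 * t).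

Let F c := Fsum q x z s t p c.

Lemma functional_eq_scaled k :
  wred x (q ^+ k * z) ((q ^+ k) ^+ 2 * t)
    * ((1 - p * q ^+ (2 * k)) * (1 - p * q ^+ (2 * k).+1)) * F (q ^+ k)
  = (1 - t * q ^+ (2 * k)) * (1 - t * q ^+ (2 * k).+1)
    * wred x (q ^+ k * s) ((q ^+ k) ^+ 2 * p) * F (q ^+ k.+1).
Proof.
have hc := norm_expq_le1 hq k; set c := q ^+ k in hc *.
(* As |c| <= 1, the rescaled sequence obeys [hY] with the same C0 and r. *)
have hcY n : `|asc (c * z) (c * s) (c ^+ 2 * t) (c ^+ 2 * p) q n| <= C0 * r ^+ n.
  rewrite asc_scale; apply: le_trans (hY n).
  by rewrite normrM ler_piMl // normrX exprn_ile1.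
have hcp := le_lt_trans (norm_scale2_le p hc) hp.
have := functional_eq hq hx hcp hr hcY.
rewrite -/(Fsum q x z s t p c) -/(F c) [q * (c * z)]mulrA [q * (c * s)]mulrA.
rewrite [q ^+ 2 * (c ^+ 2 * t)]mulrA [q ^+ 2 * (c ^+ 2 * p)]mulrA -exprMn -exprS.
rewrite -/(Fsum q x z s t p (q ^+ k.+1)) -/(F _) => h.
have e : q ^+ (2 * k) = c ^+ 2 by rewrite mulnC exprM.
by apply: (etrans _ (etrans h _)); rewrite ?[q ^+ (2 * k).+1]exprS e; ring.
Qed.

(** Each step multiplies t and p by q^2 and so uses two factors of each Pochhammer symbol, whence
    the index 2k. *)
Lemma Fsum_iter k : F 1 =
  qpoch t q (2 * k) / qpoch p q (2 * k) * pprod ratio k * F (q ^+ k).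
Proof.
elim: k => [|k ->].
  by rewrite muln0 /pprod /qpoch !big_ord0 invr1 !mul1r expr0.
rewrite (_ : 2 * k.+1 = (2 * k).+2)%N; last by rewrite mulnS.
rewrite !qpochS /pprod big_ord_recr /= -/(pprod ratio k).
have := functional_eq_scaled k; rewrite /ratio; move: (hW k).
have := qfac_gt0 hq (2 * k) hp; have := qfac_gt0 hq (2 * k).+1 hp.
have := qpoch_gt0 hq (2 * k) hp.
set w0 := wred _ _ _; set n0 := wred _ _ _.
set p1 := 1 - p * _; set p2 := 1 - p * _; set t1 := 1 - t * _; set t2 := 1 - t * _.
move=> /gt_eqF/negbT P0 /gt_eqF/negbT p20 /gt_eqF/negbT p10 w00 h.
have -> : F (q ^+ k) = t1 * t2 * n0 * F (q ^+ k.+1) / (w0 * (p2 * p1)).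
  by rewrite -h; field; rewrite w00 p10 p20.
by field; rewrite w00 p10 p20 P0.
Qed.

Lemma double_cvgn : (fun k => 2 * k)%N @ \oo --> \oo.
Proof.
apply/cvgnyPge => A; near=> n.
have : (A <= n)%N by near: n; exact: nbhs_infty_ge.
by move=> /leq_trans; apply; rewrite leq_pmull.
Unshelve. all: by end_near. Qed.

(** For large k, where F(q^k) is nonzero, [Fsum_iter] is solved for the partial product. Its
    convergence and its limit both follow from F(q^k) -> 1. *)
Lemma product_formula :
  [/\ cvgn (series (asc_term x z s t p q)), cvgn (pprod ratio)
    & limn (series (asc_term x z s t p q))
      = qpoch_inf t q / qpoch_inf p q * limn (pprod ratio)].
Proof.
have F1 : F 1 = limn (series (asc_term x z s t p q)).
  by rewrite /F /Fsum expr1n !mul1r.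
have cF : F (q ^+ k) @[k --> \oo] --> (1 : R) by exact: (Fsum_cvg1 hq hx hp hr hY).
have c1 := cvg_term1 hq hx hp hr hY.
have hT := qpoch_inf_gt0 hq ht; have hP := qpoch_inf_gt0 hq hp.
have cT : qpoch t q (2 * k)%N @[k --> \oo] --> qpoch_inf t q.
  exact: (cvg_comp _ _ double_cvgn (cvg_qpoch hq ht)).
have cP : qpoch p q (2 * k)%N @[k --> \oo] --> qpoch_inf p q.
  exact: (cvg_comp _ _ double_cvgn (cvg_qpoch hq hp)).
have H : pprod ratio @ \oo --> F 1 * (qpoch_inf p q / qpoch_inf t q) * 1^-1.
  have : (fun k => F 1 * (qpoch p q (2 * k)%N / qpoch t q (2 * k)%N)
      * (F (q ^+ k))^-1) @ \oo --> F 1 * (qpoch_inf p q / qpoch_inf t q) * 1^-1.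
    apply: cvgM; last by apply: cvgV => //; exact: oner_neq0.
    apply: cvgM; first exact: cvg_cst.
    by apply: cvgM => //; apply: cvgV => //; rewrite gt_eqF.
  apply: cvg_trans; apply: near_eq_cvg; near=> k.
  have Fk : F (q ^+ k) != 0.
    by near: k; apply: (cvgr_neq0 _ cF); exact: oner_neq0.
  rewrite (Fsum_iter k); field.
  by rewrite Fk !gt_eqF // qpoch_gt0.
split; [exact: c1 | exact: cvgP H |].
rewrite -F1 (cvg_lim _ H) // invr1 mulr1; field.
by rewrite !gt_eqF.
Unshelve. all: by end_near. Qed.

End product_formula.

(** * Specialization *)

Lemma wredE (R : numFieldType) (x z t : R) :
  wred x z t = (z - (1 + t) * x / 2) ^+ 2 + (1 - t) ^+ 2 * (4 - x ^+ 2) / 4.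
Proof. by rewrite /wred; field. Qed.

Lemma wred_ge0 (R : realType) (x z t : R) : `|x| <= 2 -> 0 <= wred x z t.
Proof.
move=> hx; rewrite wredE addr_ge0 ?sqr_ge0 // divr_ge0 // mulr_ge0 ?sqr_ge0 //.
by rewrite subr_ge0 sqr_le4.
Qed.

(** If both summands in [wredE] vanish, then x^2 = 4 and z = (1 + t) x / 2, so |z| = 1 + t. *)
Lemma wred_neq0 (R : realType) (x z t : R) :
  `|x| <= 2 -> t < 1 -> `|z| < 1 + t -> wred x z t != 0.
Proof.
move=> hx ht hz; have x4 := sqr_le4 hx.
rewrite wredE paddr_eq0 ?sqr_ge0 //; last first.
  by rewrite divr_ge0 // mulr_ge0 ?sqr_ge0 // subr_ge0.
apply/negP => /andP[]; rewrite sqrf_eq0 subr_eq0 => /eqP zE.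
rewrite !mulf_eq0 invr_eq0 pnatr_eq0 orbF orbb subr_eq0 [1 == t]gt_eqF //=.
rewrite subr_eq0 => /eqP xE.
have t0 : 0 < 1 + t by exact: le_lt_trans hz.
have : (1 + t) ^+ 2 <= `|z| ^+ 2.
  by rewrite real_normK ?num_real // zE expr_div_n exprMn -xE; lra.
by rewrite leNgt ltrXn2r ?nnegrE // ltW.
Qed.

(** Here |c z| <= 2 |c| < 1 + c^2, because (1 - |c|)^2 > 0. *)
Lemma wredMl_neq0 (R : realType) (x z c : R) :
  `|x| <= 2 -> `|z| <= 2 -> `|c| < 1 -> wred x (c * z) (c ^+ 2) != 0.
Proof.
move=> hx hz hc.
have h : c ^+ 2 = `|c| ^+ 2 by rewrite real_normK ?num_real.
apply: wred_neq0 => //; first by rewrite h exprn_ilt1.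
rewrite normrM (@le_lt_trans _ _ (`|c| * 2)) ?ler_wpM2l //.
rewrite h -subr_gt0 (_ : _ - _ = (1 - `|c|) ^+ 2); last by ring.
by rewrite exprn_gt0 // subr_gt0.
Qed.

(** With d = 1 - |c| in [asc_growth], the rate is |c| (2 - |c|) = 1 - (1 - |c|)^2. *)
Lemma asc_scale_growth (R : realType) (q z s p c : R) :
  `|q| < 1 -> `|z| <= 2 -> `|c| < 1 ->
  exists C r, 0 <= r < 1 /\
    forall n, `|asc (c * z) (c * s) (c ^+ 2) (c ^+ 2 * p) q n| <= C * r ^+ n.
Proof.
move=> hq hz hc; have d0 : 0 < 1 - `|c| by rewrite subr_gt0.
have [C C0 hC] := @asc_growth R z q (`|s| + `|p|) _ hq hz
  (addr_ge0 (normr_ge0 s) (normr_ge0 p)) d0.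
exists C, (`|c| * (1 + (1 - `|c|))); split=> [|n].
  rewrite mulr_ge0 //=; last by rewrite addr_ge0 // ltW.
  rewrite -subr_gt0 (_ : _ - _ = (1 - `|c|) ^+ 2); last by ring.
  by rewrite exprn_gt0.
have := asc_scale c z s 1 p q n; rewrite mulr1 => ->.
rewrite normrM normrX exprMn mulrCA ler_wpM2l ?exprn_ge0 //.
by apply: hC; [rewrite lerDl | rewrite lerDr].
Qed.

Lemma qpoch0 (R : fieldType) (q : R) n : qpoch 0 q n = 1.
Proof. by rewrite /qpoch big1 // => i _; rewrite mul0r subr0. Qed.

Lemma qpoch_inf0 (R : realType) (q : R) : qpoch_inf 0 q = 1.
Proof.
rewrite /qpoch_inf (_ : qpoch 0 q = cst 1) ?lim_cst //.
by apply/funext => n; rewrite qpoch0.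
Qed.

(** * Rescaling by the square root of 1 - q *)

Section normalization.
Variables (R : realType) (q : R).
Hypothesis hq : `|q| < 1.

Let u := Num.sqrt (1 - q).

Let q1 : 0 < 1 - q.
Proof. by rewrite subr_gt0 (le_lt_trans (ler_norm q)). Qed.

Let u2 : u ^+ 2 = 1 - q. Proof. by rewrite sqr_sqrtr // ltW. Qed.

Let u0 : 0 < u. Proof. by rewrite sqrtr_gt0. Qed.

Lemma suppS_norm x : suppS q x -> `|u * x| <= 2.
Proof.
rewrite /suppS /= in_itv /= => /andP[].
rewrite ler_pdivrMr // ler_pdivlMr // => h1 h2.
by rewrite ler_norml mulrC h1 h2.
Qed.

Lemma qfact_neq0 n : qfact q n != 0.
Proof.
have := qpoch_gt0 hq n hq; rewrite -qfactE => /gt_eqF/negbT.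
by rewrite mulf_eq0 negb_or => /andP[].
Qed.

Lemma w_wred x y c : w x y c q = wred (u * x) (c * (u * y)) (c ^+ 2).
Proof.
rewrite /wred /w.
rewrite (_ : (u * x) ^+ 2 = (1 - q) * x ^+ 2); last by rewrite exprMn u2.
rewrite (_ : (c * (u * y)) ^+ 2 = c ^+ 2 * ((1 - q) * y ^+ 2)); last first.
  by rewrite !exprMn u2.
rewrite (_ : _ * (c * (u * y)) = (1 + c ^+ 2) * (u ^+ 2 * x * (c * y))); last by ring.
by rewrite u2; ring.
Qed.

(** Scaling the second sequence by a / b turns its s = u b into u a, the s of the first sequence, as
    [asc_term] requires. *)
Lemma term_bigqH a b x y n : b != 0 ->
  asc_term (u * x) (a / b * (u * y)) (u * a) ((a / b) ^+ 2) 0 q n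
  = a ^+ n / (qfact q n * b ^+ n) * bigqH n x a q * bigqH n y b q.
Proof.
move=> b0; have h := asc_scale (a / b) (u * y) (u * b) 1 0 q n.
rewrite mulr1 mulr0 (_ : a / b * (u * b) = u * a) in h; last by field.
rewrite /asc_term h -!bigqH_asc // qpoch0 mulr1 -qfactE -u2 expr_div_n exprAC.
by field; rewrite qfact_neq0 !expf_neq0 // gt_eqF.
Qed.

(** In [bigB_asc] the variable is b and the shift is y; scaled by a / b they become u a and (a / b)
    u y, and the latter is the s of P_n(x|y, a / b, q). *)
Lemma term_bigB a b x y n : b != 0 -> `|a / b| < 1 ->
  asc_term (u * x) (u * a) (a / b * (u * y)) 0 ((a / b) ^+ 2) q n
  = a ^+ n / (qfact q n * b ^+ n * qpoch (a ^+ 2 / b ^+ 2) q n)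
       * bigB n y b q * ascP n x y (a / b) q.
Proof.
move=> b0 hab; have h := asc_scale (a / b) (u * b) (u * y) 0 1 q n.
rewrite mulr1 mulr0 (_ : a / b * (u * b) = u * a) in h; last by field.
have hp : `|(a / b) ^+ 2| < 1 by rewrite normrX exprn_ilt1.
rewrite /asc_term h -bigB_asc //; last exact: qfact_neq0.
rewrite [a / b * (u * y)]mulrCA -ascP_asc // -qfactE -u2 -expr_div_n.
rewrite (exprAC u) (expr_div_n a b n).
by field; rewrite (gt_eqF (qpoch_gt0 hq n hp)) qfact_neq0 !expf_neq0 // gt_eqF.
Qed.

Lemma term_ascP c1 c2 x y z n : `|c1 * c2| < 1 ->
  asc_term (u * x) (c1 * (u * z)) (c1 * c2 * (u * y)) (c1 ^+ 2) ((c1 * c2) ^+ 2) q n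
  = c1 ^+ n / (qfact q n * qpoch (c1 ^+ 2 * c2 ^+ 2) q n)
       * ascP n x y (c1 * c2) q * ascP n z y c2 q.
Proof.
move=> hc; have h := asc_scale c1 (u * z) (c2 * (u * y)) 1 (c2 ^+ 2) q n.
rewrite mulr1 (mulrA c1 c2) -exprMn in h.
have hp : `|(c1 * c2) ^+ 2| < 1 by rewrite normrX exprn_ilt1.
rewrite /asc_term h [c2 * (u * y)]mulrCA [c1 * c2 * (u * y)]mulrCA -!ascP_asc //.
rewrite -qfactE -u2 -exprMn exprAC.
by field; rewrite (gt_eqF (qpoch_gt0 hq n hp)) qfact_neq0 !expf_neq0 // gt_eqF.
Qed.

End normalization.

(** * The three sums as instances of the product formula *)

Section sums.
Variables (R : realType) (q : R).
Hypothesis hq : `|q| < 1.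

Let u := Num.sqrt (1 - q).

Lemma w_expq x y c k :
  w x y (q ^+ k * c) q = wred (u * x) (q ^+ k * (c * (u * y))) ((q ^+ k) ^+ 2 * c ^+ 2).
Proof. by rewrite w_wred // exprMn mulrA. Qed.

Lemma norm_expq_lt1 c k : `|c| < 1 -> `|q ^+ k * c| < 1.
Proof. by move=> hc; rewrite (le_lt_trans _ hc) // norm_scale_le // norm_expq_le1. Qed.

Lemma w_expq_neq0 x y c k : suppS q x -> suppS q y -> `|c| < 1 ->
  w x y (q ^+ k * c) q != 0.
Proof.
move=> hx hy hc; rewrite w_wred //.
by apply: wredMl_neq0; [exact: suppS_norm|exact: suppS_norm|exact: norm_expq_lt1].
Qed.

Lemma w_ge0 x y c : suppS q x -> 0 <= w x y c q.
Proof. by move=> hx; rewrite w_wred //; apply: wred_ge0; exact: suppS_norm. Qed.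

Lemma lim_pprod_ge0 (f : nat -> R) :
  cvgn (pprod f) -> (forall k, 0 <= f k) -> 0 <= limn (pprod f).
Proof.
by move=> cf f0; apply: limr_ge => //; near=> n; exact: prodr_ge0.
Unshelve. all: by end_near. Qed.

Lemma bigqH_num x a k :
  1 - (1 - q) * x * a * q ^+ k + (1 - q) * a ^+ 2 * q ^+ (2 * k)
  = wred (u * x) (q ^+ k * (u * a)) 0.
Proof.
have u2 : u ^+ 2 = 1 - q.
  by rewrite sqr_sqrtr // subr_ge0 ltW // (le_lt_trans (ler_norm q)).
rewrite expX2 /wred -u2; ring.
Qed.

Lemma norm_div_lt1 (a b : R) : `|b| > `|a| -> `|a / b| < 1.
Proof.
move=> hab; have b0 : 0 < `|b| by exact: le_lt_trans hab.
by rewrite normrM normfV ltr_pdivrMr // mul1r.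
Qed.

Lemma lt_norm_neq0 (a b : R) : `|b| > `|a| -> b != 0.
Proof. by move=> hab; rewrite -normr_gt0; exact: le_lt_trans hab. Qed.

Lemma bigqH_sum a b x y : `|b| > `|a| -> suppS q x -> suppS q y ->
  let s := fun n : nat =>
    a ^+ n / (qfact q n * b ^+ n) * bigqH n x a q * bigqH n y b q in
  let p := fun k : nat =>
    (1 - (1 - q) * x * a * q ^+ k + (1 - q) * a ^+ 2 * q ^+ (2 * k))
    / w x y (q ^+ k * a / b) q in
  [/\ cvgn (series s), cvgn (pprod p)
    & limn (series s) = qpoch_inf (a ^+ 2 / b ^+ 2) q * limn (pprod p)].
Proof.
move=> hab hx hy s p; have hc := norm_div_lt1 hab; have b0 := lt_norm_neq0 hab.
have hx' := suppS_norm hq hx; have hy' := suppS_norm hq hy.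
have -> : s = asc_term (u * x) (a / b * (u * y)) (u * a) ((a / b) ^+ 2) 0 q.
  by apply/funext => n; rewrite term_bigqH.
have [C [r [hr hY]]] := asc_scale_growth (u * b) 0 hq hy' hc.
rewrite mulr0 (_ : a / b * (u * b) = u * a) in hY; last by field.
have hW k : wred (u * x) (q ^+ k * (a / b * (u * y)))
    ((q ^+ k) ^+ 2 * (a / b) ^+ 2) != 0.
  by rewrite -w_expq w_expq_neq0.
have ht : `|(a / b) ^+ 2| < 1 by rewrite normrX exprn_ilt1.
have h0 : `|0 : R| < 1 by rewrite normr0.
have [c1 c2 c3] := product_formula hq hx' h0 ht hr hY hW.
have -> : p = fun k => wred (u * x) (q ^+ k * (u * a)) ((q ^+ k) ^+ 2 * 0)
   / wred (u * x) (q ^+ k * (a / b * (u * y))) ((q ^+ k) ^+ 2 * (a / b) ^+ 2).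
  by apply/funext => k; rewrite /p -[q ^+ k * a / b]mulrA -w_expq bigqH_num mulr0.
by split=> //; rewrite c3 qpoch_inf0 divr1 expr_div_n.
Qed.

(** Compared with [bigqH_sum], the pairs (z, t) and (s, p) are exchanged, which inverts each factor.
    The bound |a| sqrt (1 - q) < 1 gives both the decay of the sequence Y and nonzero
    denominators. *)
Lemma bigB_sum a b x y : `|b| > `|a| -> `|a| * u < 1 ->
  suppS q x -> suppS q y ->
  let t := fun n : nat =>
    a ^+ n / (qfact q n * b ^+ n * qpoch (a ^+ 2 / b ^+ 2) q n)
    * bigB n y b q * ascP n x y (a / b) q in
  let p := fun k : nat =>
    (1 - (1 - q) * x * a * q ^+ k + (1 - q) * a ^+ 2 * q ^+ (2 * k))
    / w x y (q ^+ k * a / b) q in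
  [/\ forall k, p k != 0, cvgn (series t), cvgn (pprod (fun k => (p k)^-1))
    & limn (series t) = (qpoch_inf (a ^+ 2 / b ^+ 2) q)^-1
        * limn (pprod (fun k => (p k)^-1))].
Proof.
move=> hab hau hx hy t p; have hc := norm_div_lt1 hab.
have b0 := lt_norm_neq0 hab; have hx' := suppS_norm hq hx.
have hua : `|u * a| < 1 by rewrite mulrC normrM (ger0_norm (sqrtr_ge0 _)).
have hW k : wred (u * x) (q ^+ k * (u * a)) ((q ^+ k) ^+ 2 * 0) != 0.
  by rewrite mulr0 wred_neq0 // addr0 norm_expq_lt1.
have pE k : p k = wred (u * x) (q ^+ k * (u * a)) ((q ^+ k) ^+ 2 * 0)
   / wred (u * x) (q ^+ k * (a / b * (u * y))) ((q ^+ k) ^+ 2 * (a / b) ^+ 2).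
  by rewrite /p -[q ^+ k * a / b]mulrA -w_expq bigqH_num mulr0.
have -> : t = asc_term (u * x) (u * a) (a / b * (u * y)) 0 ((a / b) ^+ 2) q.
  by apply/funext => n; rewrite term_bigB.
(* The midpoint of |u a| and 1: [asc0_growth] needs a rate above |u a|, [product_formula] one below
   1. *)
pose r := (1 + `|u * a|) / 2.
have hr : `|u * a| < r < 1 by rewrite /r; lra.
case/andP: hr => hr1 hr2.
have [C hY] := asc0_growth (a / b * (u * y)) ((a / b) ^+ 2) hq hr1.
have hr : 0 <= r < 1 by rewrite hr2 andbT (le_trans (normr_ge0 _) (ltW hr1)).
have hp : `|(a / b) ^+ 2| < 1 by rewrite normrX exprn_ilt1.
have h0 : `|0 : R| < 1 by rewrite normr0.
have [c1 c2 c3] := product_formula hq hx' hp h0 hr hY hW.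
have -> : (fun k => (p k)^-1) = fun k =>
    wred (u * x) (q ^+ k * (a / b * (u * y))) ((q ^+ k) ^+ 2 * (a / b) ^+ 2)
    / wred (u * x) (q ^+ k * (u * a)) ((q ^+ k) ^+ 2 * 0).
  by apply/funext => k; rewrite pE invf_div.
split=> //; last by rewrite c3 qpoch_inf0 div1r expr_div_n.
by move=> k; rewrite pE mulf_neq0 ?invr_eq0 // -w_expq w_expq_neq0.
Qed.

Lemma ascP_sum c1 c2 x y z : `|c1| < 1 -> `|c2| < 1 ->
  suppS q x -> suppS q y -> suppS q z ->
  let s := fun n : nat =>
    c1 ^+ n / (qfact q n * qpoch (c1 ^+ 2 * c2 ^+ 2) q n)
    * ascP n x y (c1 * c2) q * ascP n z y c2 q in
  let p := fun k : nat =>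
    w x y (q ^+ k * c1 * c2) q / w x z (q ^+ k * c1) q in
  [/\ cvgn (series s), cvgn (pprod p)
    & limn (series s) =
      qpoch_inf (c1 ^+ 2) q / qpoch_inf (c1 ^+ 2 * c2 ^+ 2) q
      * limn (pprod p)].
Proof.
move=> h1 h2 hx hy hz s p.
have hx' := suppS_norm hq hx; have hz' := suppS_norm hq hz.
have h12 : `|c1 * c2| < 1.
  by rewrite (le_lt_trans _ h2) // norm_scale_le // ltW.
have -> : s = asc_term (u * x) (c1 * (u * z)) (c1 * c2 * (u * y)) (c1 ^+ 2)
    ((c1 * c2) ^+ 2) q.
  by apply/funext => n; rewrite term_ascP.
have [C [r [hr hY]]] := asc_scale_growth (c2 * (u * y)) (c2 ^+ 2) hq hz' h1.
rewrite (mulrA c1 c2) -exprMn in hY.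
have hW k : wred (u * x) (q ^+ k * (c1 * (u * z))) ((q ^+ k) ^+ 2 * c1 ^+ 2) != 0.
  by rewrite -w_expq w_expq_neq0.
have ht : `|c1 ^+ 2| < 1 by rewrite normrX exprn_ilt1.
have hp : `|(c1 * c2) ^+ 2| < 1 by rewrite normrX exprn_ilt1.
have [k1 k2 k3] := product_formula hq hx' hp ht hr hY hW.
have -> : p = fun k =>
    wred (u * x) (q ^+ k * (c1 * c2 * (u * y))) ((q ^+ k) ^+ 2 * (c1 * c2) ^+ 2)
    / wred (u * x) (q ^+ k * (c1 * (u * z))) ((q ^+ k) ^+ 2 * c1 ^+ 2).
  by apply/funext => k; rewrite /p -mulrA -!w_expq.
by split=> //; rewrite k3 exprMn.
Qed.

End sums.

Theorem theorem1 (R : realType) (q : R) (hq : `|q| < 1) :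
  (forall a b x y : R, `|b| > `|a| -> suppS q x -> suppS q y ->
     let s := fun n : nat =>
       a ^+ n / (qfact q n * b ^+ n) * bigqH n x a q * bigqH n y b q in
     let p := fun k : nat =>
       (1 - (1 - q) * x * a * q ^+ k + (1 - q) * a ^+ 2 * q ^+ (2 * k))
       / w x y (q ^+ k * a / b) q in
     [/\ cvgn (series s),
         cvgn (qpoch (a ^+ 2 / b ^+ 2) q),
         cvgn (pprod p),
         0 <= limn (series s)
       & limn (series s) = qpoch_inf (a ^+ 2 / b ^+ 2) q * limn (pprod p)])
  /\
  (forall a b x y : R, `|b| > `|a| -> `|a| * Num.sqrt (1 - q) < 1 ->
     suppS q x -> suppS q y ->
     let s := fun n : nat =>
       a ^+ n / (qfact q n * b ^+ n) * bigqH n x a q * bigqH n y b q in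
     let t := fun n : nat =>
       a ^+ n / (qfact q n * b ^+ n * qpoch (a ^+ 2 / b ^+ 2) q n)
       * bigB n y b q * ascP n x y (a / b) q in
     [/\ cvgn (series s),
         limn (series s) != 0,
         cvgn (series t)
       & 1 / limn (series s) = limn (series t)])
  /\
  (forall rho1 rho2 x y z : R, `|rho1| < 1 -> `|rho2| < 1 ->
     suppS q x -> suppS q y -> suppS q z ->
     let s := fun n : nat =>
       rho1 ^+ n / (qfact q n * qpoch (rho1 ^+ 2 * rho2 ^+ 2) q n)
       * ascP n x y (rho1 * rho2) q * ascP n z y rho2 q in
     let p := fun k : nat =>
       w x y (q ^+ k * rho1 * rho2) q / w x z (q ^+ k * rho1) q in
     [/\ cvgn (series s),
         (cvgn (qpoch (rho1 ^+ 2) q)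
          /\ cvgn (qpoch (rho1 ^+ 2 * rho2 ^+ 2) q)
          /\ cvgn (pprod p)),
         0 <= limn (series s)
       & limn (series s) =
         qpoch_inf (rho1 ^+ 2) q / qpoch_inf (rho1 ^+ 2 * rho2 ^+ 2) q
         * limn (pprod p)]).
Proof.
have sqr_lt1 (c : R) : `|c| < 1 -> `|c ^+ 2| < 1.
  by move=> hc; rewrite normrX exprn_ilt1.
have div_lt1 (a b : R) : `|b| > `|a| -> `|a ^+ 2 / b ^+ 2| < 1.
  by move=> hab; rewrite -expr_div_n sqr_lt1 // norm_div_lt1.
split; [|split].
- move=> a b x y hab hx hy s p.
  have [cs cp E] := bigqH_sum hq hab hx hy.
  split; [exact: cs | exact: cvg_qpoch (div_lt1 _ _ hab) | exact: cp | | exact: E].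
  rewrite E mulr_ge0 ?(ltW (qpoch_inf_gt0 hq (div_lt1 _ _ hab))) //.
  apply: lim_pprod_ge0 cp _ => k; rewrite divr_ge0 ?w_ge0 //.
  by rewrite bigqH_num // wred_ge0 // suppS_norm.
- move=> a b x y hab hau hx hy s t.
  have [cs cp E] := bigqH_sum hq hab hx hy; set p := fun k => _ in cp E.
  have [p0 ct cpV EV] : [/\ forall k, p k != 0, cvgn (series t),
      cvgn (pprod (fun k => (p k)^-1)) & limn (series t)
      = (qpoch_inf (a ^+ 2 / b ^+ 2) q)^-1 * limn (pprod (fun k => (p k)^-1))].
    exact: bigB_sum.
  have c0 := gt_eqF (qpoch_inf_gt0 hq (div_lt1 _ _ hab)).
  (* The partial products of p and of its reciprocals multiply to 1, so neither limit is zero; this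
     gives the nonvanishing of the sum and the reciprocity. *)
  have EP : limn (pprod p) * limn (pprod (fun k => (p k)^-1)) = 1.
    rewrite -limM // (_ : _ \* _ = cst 1) ?lim_cst //.
    apply/funext => n; rewrite /pprod /= -big_split /= big1 // => i _.
    by rewrite divff.
  have lp0 : limn (pprod p) != 0.
    by apply/eqP => h; move/eqP: EP; rewrite h mul0r eq_sym oner_eq0.
  have ls0 : limn (series s) != 0 by rewrite E mulf_neq0 // c0.
  split; [exact: cs | exact: ls0 | exact: ct |].
  rewrite EV E -[1]EP; field.
  by rewrite c0 lp0.
- move=> c1 c2 x y z h1 h2 hx hy hz s p.
  have [cs cp E] := ascP_sum hq h1 h2 hx hy hz.
  have h12 : `|c1 ^+ 2 * c2 ^+ 2| < 1.
    by rewrite (le_lt_trans _ (sqr_lt1 _ h2)) // norm_scale_le // ltW // sqr_lt1.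
  have c1p := qpoch_inf_gt0 hq (sqr_lt1 _ h1).
  have c12p := qpoch_inf_gt0 hq h12.
  split; [exact: cs | | | exact: E].
    by split; [|split; [|exact: cp]]; apply: cvg_qpoch => //; exact: sqr_lt1.
  rewrite E mulr_ge0 ?divr_ge0 ?(ltW c1p) ?(ltW c12p) //.
  by apply: lim_pprod_ge0 cp _ => k; rewrite divr_ge0 // w_ge0.
Qed.
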